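(* Let $D\subseteq\mathbb N$, let $k\geq 2$ be even, and let $\phi(x_0,x_1,\ldots,x_k)$ be a $\Delta_0$-formula of arithmetic such that for all $n\in\mathbb N$: $n\in D$ if and only if $\mathbb N\models\forall x_1\exists x_2\cdots\forall x_{k-1}\exists x_k\,\phi(n,x_1,\ldots,x_k)$. Then $D$ is effective in $\mathcal F^*$.
   Context: Write $e(n)$ for the (possibly undefined) value at $n$ of the $e$-th partial recursive function, and $\langle\cdot,\cdot\rangle$ for a fixed recursive bijective pairing on $\mathbb{N}$. $\mathcal P(X)$ is the power set. For $A,B\subseteq\mathbb{N}$ put $A\Rightarrow B=\{e : \text{for all } a\in A,\ e(a)\text{ is defined and } e(a)\in B\}$ and $A\wedge B=\{\langle a,b\rangle : a\in A, b\in B\}$. For $h,k:\mathcal P(\mathbb N)\to\mathcal P(\mathbb N)$ write $h\le k$ if $\bigcap_{p\subseteq\mathbb N}(h(p)\Rightarrow k(p))\ne\emptyset$. A local operator (Lawvere–Tierney topology) on the effective topos $\mathbf{Eff}$ is represented by a function $j:\mathcal P(\mathbb N)\to\mathcal P(\mathbb N)$ such that $\bigcap_p(p\Rightarrow j(p))$, $\bigcap_{p,q}(j(p\Rightarrow q)\Rightarrow(j(p)\Rightarrow j(q)))$ and $\bigcap_p(j(j(p))\Rightarrow j(p))$ are non-empty; local operators are ordered by $\le$ (functions $j,k$ with $j\le k\le j$ representing the same one). For $\theta:\mathbb N\to\mathcal P(\mathcal P(\mathbb N))$ put $\mathrm{mo}_\theta(p)=\{\langle n,e\rangle : \exists A\in\theta(n),\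 e\in(A\Rightarrow p)\}$, and let $\mathrm{lo}_\theta$ be the least local operator $j$ with $\mathrm{mo}_\theta\le j$; it is represented by $\mathrm{lo}_\theta(p)=\bigcap_{q\subseteq\mathbb N}\big(((\mathrm{mo}_\theta(q)\Rightarrow q)\wedge(p\Rightarrow q))\Rightarrow q\big)$. Write $\eta\le_{\mathrm{lo}}\theta$ if $\mathrm{lo}_\eta\le\mathrm{lo}_\theta$. A collection $\mathcal A\in\mathcal P(\mathcal P(\mathbb N))$ is identified with the constant function $\mathbb N\to\mathcal P(\mathcal P(\mathbb N))$ with value $\mathcal A$. For $D\subseteq\mathbb N$, $\rho_D:\mathbb N\to\mathcal P(\mathcal P(\mathbb N))$ is $\rho_D(n)=\{\{0\}\}$ if $n\in D$ and $\rho_D(n)=\{\{1\}\}$ otherwise. $D$ is effective in $\theta$ (i.e. in the subtopos given by $\theta$) if $\rho_D\le_{\mathrm{lo}}\theta$; equivalently, $\bigcap_{n}(\{n\}\Rightarrow\mathrm{lo}_\theta(\{\chi_D(n)\}))\neq\emptyset$, where $\chi_D(n)=0$ if $n\in D$ and $1$ otherwise. $\mathcal F^*$ is the collection of all cofinite subsets of $\mathbb N$. (It is $\cong_{\mathrm{lo}}$ to Pitts's example $\{\{m : m\ge n\} : n\in\mathbb N\}$.) *)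

(* Defs.v *)
(* World: MathComp (with the classical sets of mathcomp-classical); the
   pairing on nat is Stdlib's Cantor pairing. *)
From Stdlib Require Cantor.
From mathcomp Require Import all_boot.
From mathcomp Require Import boolp classical_sets functions cardinality.

Set Implicit Arguments.
Unset Strict Implicit.
Unset Printing Implicit Defensive.

Local Open Scope classical_set_scope.
Local Open Scope nat_scope.

Notation "<| m , n |>" := (Cantor.to_nat (m, n))
  (at level 0, m at level 99, n at level 99, format "<| m ,  n |>").

(* Codes of unary partial recursive functions; functions of several arguments
   are read through the pairing <| _, _ |>. *)
Inductive code : Type :=
| Czero
| Csucc
| Cleft
| Cright
| Cpair of code & code
| Ccomp of code & code
| Cprec of code & code
| Cmu of code.

Fixpoint prec_graph (F G : nat -> nat -> Prop) (a n y : nat) : Prop :=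
  if n is n'.+1
  then exists2 r, prec_graph F G a n' r & G <| a, <| n', r |> |> y
  else F a y.

(* [eval c x y] is the graph of the partial function coded by c: its value at x
   is defined and equal to y. *)
Fixpoint eval (c : code) (x y : nat) : Prop :=
  match c with
  | Czero => y = 0
  | Csucc => y = x.+1
  | Cleft => y = (Cantor.of_nat x).1
  | Cright => y = (Cantor.of_nat x).2
  | Cpair c1 c2 =>
      exists u v, [/\ eval c1 x u, eval c2 x v & y = <| u, v |>]
  | Ccomp c1 c2 => exists2 z, eval c2 x z & eval c1 z y
  | Cprec c1 c2 =>
      prec_graph (eval c1) (eval c2) (Cantor.of_nat x).1 (Cantor.of_nat x).2 y
  | Cmu c1 =>
      eval c1 <| x, y |> 0 /\
      forall i, i < y -> exists k, eval c1 <| x, i |> k.+1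
  end.

Fixpoint encode (c : code) : nat :=
  match c with
  | Czero => <| 0, 0 |>
  | Csucc => <| 1, 0 |>
  | Cleft => <| 2, 0 |>
  | Cright => <| 3, 0 |>
  | Cpair c1 c2 => <| 4, <| encode c1, encode c2 |> |>
  | Ccomp c1 c2 => <| 5, <| encode c1, encode c2 |> |>
  | Cprec c1 c2 => <| 6, <| encode c1, encode c2 |> |>
  | Cmu c1 => <| 7, encode c1 |>
  end.

(* [app e n m]: e(n) is defined and equal to m. An index that is not of the form
   [encode c] denotes the nowhere defined function. *)
Definition app (e n m : nat) : Prop := exists2 c, encode c = e & eval c n m.

Lemma eval_functional c x y z : eval c x y -> eval c x z -> y = z.
Proof.
elim: c x y z => [||||c1 IH1 c2 IH2|c1 IH1 c2 IH2|c1 IH1 c2 IH2|c IH] x y z /=.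
- by move=> -> ->.
- by move=> -> ->.
- by move=> -> ->.
- by move=> -> ->.
- case=> [u [v [hu hv ->]]] [u' [v' [hu' hv' ->]]].
  by rewrite (IH1 _ _ _ hu hu') (IH2 _ _ _ hv hv').
- case=> [u hu hy] [u' hu' hz]; move: hz; rewrite -(IH2 _ _ _ hu hu').
  exact: IH1.
- elim: (Cantor.of_nat x).2 y z => [|n IHn] y z /=; first exact: IH1.
  case=> [r hr hy] [r' hr' hz]; move: hz; rewrite -(IHn _ _ hr hr').
  exact: IH2.
- case=> [hy ly] [hz lz]; case: (ltngtP y z) => // [/lz|/ly] [k hk].
    by have := IH _ _ _ hy hk.
  by have := IH _ _ _ hz hk.
Qed.

Lemma encode_inj : injective encode.
Proof.
elim=> [||||c1 IH1 c2 IH2|c1 IH1 c2 IH2|c1 IH1 c2 IH2|c IH] [||||d1 d2|d1 d2|d1 d2|d];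
  move=> /(Cantor.to_nat_inj (_, _) (_, _)) // [] //.
- by move=> /(Cantor.to_nat_inj (_, _) (_, _)) [/IH1-> /IH2->].
- by move=> /(Cantor.to_nat_inj (_, _) (_, _)) [/IH1-> /IH2->].
- by move=> /(Cantor.to_nat_inj (_, _) (_, _)) [/IH1-> /IH2->].
- by move=> /IH->.
Qed.

Lemma app_functional e n m m' : app e n m -> app e n m' -> m = m'.
Proof.
by case=> [c <- h] [c' /encode_inj-> h']; exact: eval_functional h h'.
Qed.

Definition rimp (A B : set nat) : set nat :=
  [set e | forall a, A a -> exists2 b, app e a b & B b].

Definition rand (A B : set nat) : set nat :=
  [set x | exists a b, [/\ A a, B b & x = <| a, b |>]].

Notation "A ~~> B" := (rimp A B) (at level 55, right associativity).
Notation "A /^\ B" := (rand A B) (at level 50, left associativity).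

Definition le_op (h k : set nat -> set nat) : Prop :=
  (\bigcap_p (h p ~~> k p)) !=set0.

Definition mo (theta : nat -> set (set nat)) (p : set nat) : set nat :=
  [set x | exists n e, x = <| n, e |> /\ exists2 A, theta n A & (A ~~> p) e].

(* The standard representative of the least local operator above [mo theta]. *)
Definition lo (theta : nat -> set (set nat)) (p : set nat) : set nat :=
  \bigcap_q (((mo theta q ~~> q) /^\ (p ~~> q)) ~~> q).

Definition le_lo (eta theta : nat -> set (set nat)) : Prop :=
  le_op (lo eta) (lo theta).

Definition rho (D : set nat) (n : nat) : set (set nat) :=
  if n \in D then [set [set 0]] else [set [set 1]].

Definition effective_in (D : set nat) (theta : nat -> set (set nat)) : Prop :=
  le_lo (rho D) theta.

Definition cofinite_sets : set (set nat) := [set A | finite_set (~` A)].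

(* First-order arithmetic in the language 0, 1, +, *, <, with named variables
   x_0, x_1, and so on. *)
Inductive term : Type :=
| Var of nat
| Zero
| One
| Add of term & term
| Mul of term & term.

Inductive formula : Type :=
| Eq of term & term
| Lt of term & term
| Not of formula
| And of formula & formula
| Or of formula & formula
| Imp of formula & formula
| All of nat & formula
| Ex of nat & formula.

Fixpoint term_vars (t : term) : seq nat :=
  match t with
  | Var i => [:: i]
  | Zero | One => [::]
  | Add s t | Mul s t => term_vars s ++ term_vars t
  end.

Fixpoint free_vars (f : formula) : seq nat :=
  match f with
  | Eq s t | Lt s t => term_vars s ++ term_vars t
  | Not f => free_vars f
  | And f g | Or f g | Imp f g => free_vars f ++ free_vars g
  | All i f | Ex i f => [seq j <- free_vars f | j != i]
  end.

Fixpoint term_val (v : nat -> nat) (t : term) : nat :=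
  match t with
  | Var i => v i
  | Zero => 0
  | One => 1
  | Add s t => term_val v s + term_val v t
  | Mul s t => term_val v s * term_val v t
  end.

Definition update (v : nat -> nat) (i a : nat) : nat -> nat :=
  fun j => if j == i then a else v j.

(* Satisfaction in the standard model. *)
Fixpoint sat (v : nat -> nat) (f : formula) : Prop :=
  match f with
  | Eq s t => term_val v s = term_val v t
  | Lt s t => term_val v s < term_val v t
  | Not f => ~ sat v f
  | And f g => sat v f /\ sat v g
  | Or f g => sat v f \/ sat v g
  | Imp f g => sat v f -> sat v g
  | All i f => forall a, sat (update v i a) f
  | Ex i f => exists a, sat (update v i a) f
  end.

Inductive Delta0 : formula -> Prop :=
| Delta0_Eq s t : Delta0 (Eq s t)
| Delta0_Lt s t : Delta0 (Lt s t)
| Delta0_Not f : Delta0 f -> Delta0 (Not f)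
| Delta0_And f g : Delta0 f -> Delta0 g -> Delta0 (And f g)
| Delta0_Or f g : Delta0 f -> Delta0 g -> Delta0 (Or f g)
| Delta0_Imp f g : Delta0 f -> Delta0 g -> Delta0 (Imp f g)
| Delta0_All i t f : i \notin term_vars t -> Delta0 f ->
    Delta0 (All i (Imp (Lt (Var i) t) f))
| Delta0_Ex i t f : i \notin term_vars t -> Delta0 f ->
    Delta0 (Ex i (And (Lt (Var i) t) f)).

(* [alternating true i r f] is the formula "forall x_i, exists x_(i+1), ... f"
   with r alternating quantifiers; with [false] it starts with "exists". *)
Fixpoint alternating (b : bool) (i r : nat) (f : formula) : formula :=
  if r is r'.+1
  then (if b then All else Ex) i (alternating (~~ b) i.+1 r' f)
  else f.

(* Truth of f(n), for f with no free variable other than x_0 (so that the value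
   given to the other variables is irrelevant). *)
Definition holds_at (f : formula) (n : nat) : Prop :=
  sat (update (fun=> 0) 0 n) f.

(* Main.v *)
(* A realizer of an element of lo(p), for the cofinite topology, is a
   computation of an element of p that may ask for numbers m that are "large
   enough", the bound depending on the history of the computation. The truth
   value of a statement "for all y, P(y)" is that of "for all y < m, P(y)" for
   every large m. Since lo is a monad, the finitely many instances P(y) may
   themselves be decided in lo, so every arithmetical formula can be decided in
   lo by induction on the formula. Composing realizers takes a universal code,
   obtained by running a stack machine. *)
Require Import Defs.
From mathcomp Require Import all_boot.
From mathcomp Require Import boolp classical_sets functions cardinality.

Set Implicit Arguments.
Unset Strict Implicit.
Unset Printing Implicit Defensive.

Local Open Scope classical_set_scope.
Local Open Scope nat_scope.

Definition pi1 (x : nat) : nat := (Cantor.of_nat x).1.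
Definition pi2 (x : nat) : nat := (Cantor.of_nat x).2.

Lemma pi1_pair a b : pi1 <|a, b|> = a.
Proof. by rewrite /pi1 Cantor.cancel_of_to. Qed.

Lemma pi2_pair a b : pi2 <|a, b|> = b.
Proof. by rewrite /pi2 Cantor.cancel_of_to. Qed.

Lemma pair_pi x : <|pi1 x, pi2 x|> = x.
Proof. by rewrite /pi1 /pi2 -surjective_pairing Cantor.cancel_to_of. Qed.

Lemma pi2_0 : pi2 0 = 0. Proof. by []. Qed.

Definition piE := (pi1_pair, pi2_pair).

(* Computing pairs of closed numerals would build large unary numbers. *)
Local Opaque Cantor.to_nat Cantor.of_nat.

(** * Total computable functions *)

Definition computable (f : nat -> nat) : Prop :=
  exists c, forall x, eval c x (f x).

Lemma computable_ext f g : f =1 g -> computable f -> computable g.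
Proof. by move=> fg [c cf]; exists c => x; rewrite -fg. Qed.

Lemma computable_comp f g :
  computable f -> computable g -> computable (fun x => f (g x)).
Proof. by move=> [c cf] [d dg]; exists (Ccomp c d) => x; exists (g x). Qed.

Lemma computable_pair f g :
  computable f -> computable g -> computable (fun x => <|f x, g x|>).
Proof.
by move=> [c cf] [d dg]; exists (Cpair c d) => x; exists (f x), (g x).
Qed.

Lemma computable_pi1 f : computable f -> computable (fun x => pi1 (f x)).
Proof. by apply: (computable_comp (f := pi1)); exists Cleft. Qed.

Lemma computable_pi2 f : computable f -> computable (fun x => pi2 (f x)).
Proof. by apply: (computable_comp (f := pi2)); exists Cright. Qed.

Lemma computable_succ f : computable f -> computable (fun x => (f x).+1).
Proof. by apply: (computable_comp (f := S)); exists Csucc. Qed.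

Lemma eval_id x : eval (Cpair Cleft Cright) x x.
Proof. by exists (pi1 x), (pi2 x); split=> //; rewrite pair_pi. Qed.

Lemma computable_id : computable (fun x => x).
Proof. exact: (ex_intro _ _ eval_id). Qed.

Fixpoint numeral (n : nat) : code :=
  if n is n'.+1 then Ccomp Csucc (numeral n') else Czero.

Lemma eval_numeral n x : eval (numeral n) x n.
Proof. by elim: n => //= n IHn; exists n. Qed.

Lemma computable_const n : computable (fun=> n).
Proof. by exists (numeral n); exact: eval_numeral. Qed.

Lemma computable_rec f g (h : nat -> nat -> nat) u v :
    computable f -> computable g ->
    (forall a, h a 0 = f a) -> (forall a n, h a n.+1 = g <|a, <|n, h a n|>|>) ->
  computable u -> computable v -> computable (fun x => h (u x) (v x)).
Proof.
move=> [c cf] [d dg] h0 hS cu cv.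
have ch : computable (fun x => h (pi1 x) (pi2 x)).
  exists (Cprec c d) => x /=; rewrite -/(pi1 x) -/(pi2 x).
  elim: (pi2 x) => [|n IHn] /=; first by rewrite h0.
  by exists (h (pi1 x) n); rewrite ?hS.
apply: computable_ext (computable_comp ch (computable_pair cu cv)) => x.
by rewrite !piE.
Qed.

Lemma computable_if0 t f g : computable t -> computable f -> computable g ->
  computable (fun x => if t x == 0 then f x else g x).
Proof.
move=> ct cf cg.
by apply: (computable_rec (h := fun a n => if n == 0 then f a else g a)
            cf (computable_comp cg (computable_pi1 computable_id)) _ _
            computable_id ct) => // a n; rewrite piE.
Qed.

Ltac computability :=
  cbv beta; 
  repeat first
    [ assumption
    | simple apply computable_id
    | simple apply computable_const
    | simple apply computable_pair
    | simple apply computable_pi1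
    | simple apply computable_pi2
    | simple apply computable_succ
    | simple apply computable_if0
    | match goal with
      | H : computable ?f |- computable (fun x => ?f (@?g x)) =>
          apply: (computable_comp (f := f) (g := g) H)
      end ].

Lemma computable_add f g :
  computable f -> computable g -> computable (fun x => f x + g x).
Proof.
apply: (computable_rec (f := id) (g := fun x => (pi2 (pi2 x)).+1)) => [||a|a n].
- by computability.
- by computability.
- exact: addn0.
- by rewrite !piE addnS.
Qed.

Lemma computable_mul f g :
  computable f -> computable g -> computable (fun x => f x * g x).
Proof.
apply: (computable_rec (f := fun=> 0) (g := fun x => pi1 x + pi2 (pi2 x)))
  => [||a|a n].
- by computability.
- by apply: computable_add; computability.
- exact: muln0.
- by rewrite !piE mulnS.
Qed.

Lemma computable_pred f : computable f -> computable (fun x => (f x).-1).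
Proof.
move=> cf; apply: (computable_rec (f := fun=> 0) (g := fun x => pi1 (pi2 x))
  (h := fun _ n => n.-1) (u := id) _ _ _ _ _ cf) => // [||a n|];
  try by computability.
by rewrite !piE.
Qed.

Lemma computable_sub f g :
  computable f -> computable g -> computable (fun x => f x - g x).
Proof.
apply: (computable_rec (f := id) (g := fun x => (pi2 (pi2 x)).-1)) => [||a|a n].
- by computability.
- by apply: computable_pred; computability.
- exact: subn0.
- by rewrite !piE subnS.
Qed.

Lemma computable_nth t fs d : computable t -> computable d ->
    foldr (fun f => and (computable f)) True fs ->
  computable (fun x => nth d fs (t x) x).
Proof.
move=> + cd; elim: fs t => [|f fs IHfs] t ct /=.
  by move=> _; apply: computable_ext cd => x; rewrite nth_nil.
case=> cf /(IHfs (fun x => (t x).-1)) ctl.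
have {}ctl := ctl (computable_pred ct).
by apply: computable_ext (computable_if0 ct cf ctl) => x; case: (t x).
Qed.

(** * A universal code *)

(* A state [<| <|I, K|>, x|>] of the machine consists of the current
   instruction I, the stack K of pending instructions and the current value x.
   Tags 0 to 7 are those of [encode]; an instruction with tag 8 to 11 resumes a
   pairing (8, 9), a recursion (10) or a search (11); all others halt. *)
Definition cur_args (st : nat) : nat := pi2 (pi1 (pi1 st)).
Definition pending (st : nat) : nat := pi2 (pi1 st).
Definition cur_tag (st : nat) : nat := pi1 (pi1 (pi1 st)).

Definition transitions : seq (nat -> nat) :=
  [:: (fun st => <|pending st, 0|>);
      (fun st => <|pending st, (pi2 st).+1|>);
      (fun st => <|pending st, pi1 (pi2 st)|>);
      (fun st => <|pending st, pi2 (pi2 st)|>);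
      (fun st => <| <|pi1 (cur_args st),
                      <| <|8, <|pi2 (cur_args st), pi2 st|>|>, pending st|>|>,
                    pi2 st|>);
      (fun st => <| <|pi2 (cur_args st), <|pi1 (cur_args st), pending st|>|>,
                    pi2 st|>);
      (fun st => if pi2 (pi2 st) == 0
         then <| <|pi1 (cur_args st), pending st|>, pi1 (pi2 st)|>
         else <| <|pi1 (pi1 st),
                   <| <|10, <|pi2 (cur_args st),
                              <|pi1 (pi2 st), (pi2 (pi2 st)).-1|>|>|>,
                      pending st|>|>,
                 <|pi1 (pi2 st), (pi2 (pi2 st)).-1|>|>);
      (fun st => <| <|cur_args st,
                      <| <|11, <|cur_args st, <|pi2 st, 0|>|>|>, pending st|>|>,
                    <|pi2 st, 0|>|>);
      (fun st => <| <|pi1 (cur_args st), <| <|9, pi2 st|>, pending st|>|>,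
                    pi2 (cur_args st)|>);
      (fun st => <|pending st, <|cur_args st, pi2 st|>|>);
      (fun st => <| <|pi1 (cur_args st), pending st|>,
                    <|pi1 (pi2 (cur_args st)),
                      <|pi2 (pi2 (cur_args st)), pi2 st|>|>|>);
      (fun st => if pi2 st == 0
         then <|pending st, pi2 (pi2 (cur_args st))|>
         else <| <|pi1 (cur_args st),
                   <| <|11, <|pi1 (cur_args st),
                              <|pi1 (pi2 (cur_args st)),
                                (pi2 (pi2 (cur_args st))).+1|>|>|>,
                      pending st|>|>,
                 <|pi1 (pi2 (cur_args st)),
                   (pi2 (pi2 (cur_args st))).+1|>|>)].

Definition step (st : nat) : nat := nth id transitions (cur_tag st) st.

Lemma computable_step : computable step.
Proof.
apply: (computable_nth (t := cur_tag)).
- by rewrite /cur_tag; computability.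
- exact: computable_id.
rewrite /transitions /cur_args /pending.
by do 12![split; first by computability; apply: computable_pred; computability].
Qed.

Lemma computable_iter_step f g :
  computable f -> computable g -> computable (fun x => iter (f x) step (g x)).
Proof.
move=> cf cg; have cstep := computable_step.
apply: (computable_rec (f := id) (g := fun x => step (pi2 (pi2 x)))
  (h := fun a n => iter n step a) _ _ _ _ cg cf) => // [||a n].
- exact: computable_id.
- by computability.
- by rewrite !piE.
Qed.

Definition reaches (st st' : nat) : Prop := exists n, iter n step st = st'.

Lemma reaches_refl st : reaches st st.
Proof. by exists 0. Qed.

Lemma reaches_trans st2 st1 st3 :
  reaches st1 st2 -> reaches st2 st3 -> reaches st1 st3.
Proof. by move=> [n <-] [m <-]; exists (m + n); rewrite iterD. Qed.

Lemma reaches_step st st' : reaches (step st) st' -> reaches st st'.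
Proof. by apply: reaches_trans; exists 1. Qed.

Lemma stepE t d K x : step <| <| <|t, d|>, K|>, x|> =
  nth id transitions t <| <| <|t, d|>, K|>, x|>.
Proof. by rewrite /step /cur_tag !piE. Qed.

Ltac machine_step :=
  apply: reaches_step; rewrite stepE;
  lazy beta iota delta [nth transitions cur_args pending]; rewrite !piE /=.

Lemma eval_reaches c x y K : eval c x y -> reaches <| <|encode c, K|>, x|> <|K, y|>.
Proof.
elim: c x y K => [||||c IHc d IHd|c IHc d IHd|c IHc d IHd|c IHc] x y K /=.
- by move=> ->; machine_step; exact: reaches_refl.
- by move=> ->; machine_step; exact: reaches_refl.
- by move=> ->; machine_step; exact: reaches_refl.
- by move=> ->; machine_step; exact: reaches_refl.
- move=> [u [v [cu dv ->]]]; machine_step.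
  apply: reaches_trans (IHc _ _ _ cu) _; machine_step.
  apply: reaches_trans (IHd _ _ _ dv) _; machine_step.
  exact: reaches_refl.
- move=> [z dz cy]; machine_step.
  by apply: reaches_trans (IHd _ _ _ dz) _; exact: IHc.
- rewrite -/(pi1 x) -/(pi2 x) -{3}[x]pair_pi.
  elim: (pi2 x) y K => [|n IHn] y K /=.
    by move=> cy; machine_step; exact: IHc.
  move=> [r rn dy]; machine_step.
  by apply: reaches_trans (IHn _ _ rn) _; machine_step; exact: IHd.
- move=> [cy cS]; machine_step.
  suff search i : i <= y ->
      reaches <| <|encode c, <| <|11, <|encode c, <|x, y - i|>|>|>, K|>|>,
                 <|x, y - i|>|> <|K, y|>.
    by have := search y (leqnn y); rewrite subnn.
  elim: i => [_|i IHi lt_iy].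
    rewrite subn0; apply: reaches_trans (IHc _ _ _ cy) _; machine_step.
    exact: reaches_refl.
  have [|k ck] := cS (y - i.+1); first by rewrite ltn_subrL (leq_trans _ lt_iy).
  apply: reaches_trans (IHc _ _ _ ck) _; machine_step.
  by rewrite -subSn // subSS; apply: IHi; exact: ltnW.
Qed.

Lemma iter_step_halted n st : 12 <= cur_tag st -> iter n step st = st.
Proof.
by move=> halted; elim: n => //= n ->; rewrite /step nth_default.
Qed.

Lemma universal_code : exists c, forall e n m, app e n m -> eval c <|e, n|> m.
Proof.
pose start x := <| <|pi1 x, <| <|12, 0|>, 0|>|>, pi2 x|>.
pose timer x := 12 - cur_tag (iter (pi2 x) step (start (pi1 x))).
have [c ctimer] : computable timer.
  apply: computable_sub; rewrite /cur_tag /start; computability.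
  by apply: computable_iter_step; computability.
have [d dout] : computable (fun x => pi2 (iter (pi2 x) step (start (pi1 x)))).
  rewrite /start; computability.
  by apply: computable_iter_step; computability.
exists (Ccomp d (Cpair (Cpair Cleft Cright) (Cmu c))) => e n m [e' <- e'm].
set x := <|_, n|>.
have [k runk] := eval_reaches <| <|12, 0|>, 0|> e'm.
have {}runk : iter k step (start x) = <| <| <|12, 0|>, 0|>, m|>.
  by rewrite /start /x !piE.
have halt : exists i, timer <|x, i|> == 0.
  by exists k; rewrite /timer !piE runk /cur_tag !piE.
case: (ex_minnP halt) => i /eqP timer0 min_i.
have le_ik : i <= k by apply: min_i; rewrite /timer !piE runk /cur_tag !piE.
exists <|x, i|>.
  exists x, i; split=> //; first exact: eval_id.
  split=> [|j lt_ji]; first by rewrite -timer0.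
  exists (timer <|x, j|>).-1; rewrite prednK //.
  by rewrite lt0n; apply: contraL lt_ji => /min_i; rewrite -leqNgt.
have -> : m = pi2 (iter (pi2 <|x, i|>) step (start (pi1 <|x, i|>))).
  move: timer0; rewrite /timer !piE => /eqP; rewrite subn_eq0 => halted.
  by rewrite -(iter_step_halted (k - i) halted) -iterD subnK // runk piE.
exact: dout.
Qed.

(** * Realizers *)

Lemma eval_precomp c g : computable g ->
  exists c', forall x y, eval c (g x) y -> eval c' x y.
Proof. by move=> [d dg]; exists (Ccomp c d) => x y cy; exists (g x). Qed.

Lemma app_precomp g : computable g ->
  exists c, forall x y, app (pi1 (g x)) (pi2 (g x)) y -> eval c x y.
Proof.
have [c cU] := universal_code => cg; have [d dg] := eval_precomp c cg.
by exists d => x y /cU; rewrite pair_pi; exact: dg.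
Qed.

Lemma smn c : exists2 S, computable S &
  forall a x y, eval c <|a, x|> y -> app (S a) x y.
Proof.
pose curried a := Ccomp c (Cpair (numeral a) (Cpair Cleft Cright)).
exists (fun a => encode (curried a)).
  have cnum : computable (fun a => encode (numeral a)).
    apply: (computable_rec (f := fun=> <|0, 0|>)
      (g := fun x => <|5, <| <|1, 0|>, pi2 (pi2 x)|>|>) (u := id)
      (h := fun _ n => encode (numeral n)) _ _ _ _ _ computable_id)
      => // [||a n|]; try by computability.
    by rewrite !piE.
  by rewrite /=; computability; exact: cnum.
move=> a x y cy; exists (curried a) => //.
exists <|a, x|> => //; exists a, x.
by split=> //; [exact: eval_numeral | exact: eval_id].
Qed.

Lemma abstraction c g : computable g ->
  exists2 S, computable S & forall a x y, eval c (g <|a, x|>) y -> app (S a) x y.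
Proof.
move=> /(eval_precomp c) [d dg]; have [S cS Sd] := smn d.
by exists S => // a x y /dg /Sd.
Qed.

(* Uniformly in x, a realizer of [lo theta [set f x]], in uncurried form. *)
Definition lo_computable (theta : nat -> set (set nat)) (f : nat -> nat) : Prop :=
  exists c, forall x q r s, (mo theta q ~~> q) r -> ([set f x] ~~> q) s ->
    exists2 y, eval c <|x, <|r, s|>|> y & q y.

Section LoComputable.
Variable theta : nat -> set (set nat).
Implicit Types f g h : nat -> nat.

Lemma lo_computable_ext f g :
  f =1 g -> lo_computable theta f -> lo_computable theta g.
Proof.
by move=> fg [c cf]; exists c => x q r s hr hs; apply: cf => //; rewrite fg.
Qed.

Lemma computable_lo_computable f : computable f -> lo_computable theta f.
Proof.
move=> cf.
have [|c cE] := app_precomp (g := fun x => <|pi2 (pi2 x), f (pi1 x)|>).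
  by computability.
exists c => x q r s _ /(_ (f x) erefl) [y sy qy]; exists y => //.
by apply: cE; rewrite !piE.
Qed.

Lemma lo_computable_precomp f g :
  lo_computable theta f -> computable g -> lo_computable theta (fun x => f (g x)).
Proof.
move=> [c cf] cg.
have [|d dE] := eval_precomp c (g := fun x => <|g (pi1 x), pi2 x|>).
  by computability.
exists d => x q r s hr hs; have [y cy qy] := cf (g x) q r s hr hs.
by exists y => //; apply: dE; rewrite !piE.
Qed.

Lemma lo_computable_bind f g : lo_computable theta f -> lo_computable theta g ->
  lo_computable theta (fun x => g <|x, f x|>).
Proof.
move=> [c cf] [d dg].
have [|S cS SE] := abstraction d
  (g := fun z => <| <|pi1 (pi1 z), pi2 z|>, pi2 (pi1 z)|>); first by computability.
have [|b bE] := eval_precomp c (g := fun z => <|pi1 z, <|pi1 (pi2 z), S z|>|>).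
  by computability.
exists b => x q r s hr hs.
have [|y cy qy] := cf x q r (S <|x, <|r, s|>|>) hr.
  move=> u ->; have [y dy qy] := dg <|x, f x|> q r s hr hs.
  by exists y => //; apply: SE; rewrite !piE.
by exists y => //; apply: bE; rewrite !piE.
Qed.

Lemma lo_computable_op f g h :
    lo_computable theta f -> lo_computable theta g -> computable h ->
  lo_computable theta (fun x => h <|f x, g x|>).
Proof.
move=> lf lg ch.
have lgh : lo_computable theta (fun z => h <|pi2 z, g (pi1 z)|>).
  have lg1 : lo_computable theta (fun z => g (pi1 z)).
    by apply: lo_computable_precomp lg _; computability.
  have ch1 : computable (fun w => h <|pi2 (pi1 w), pi2 w|>) by computability.
  apply: lo_computable_ext (lo_computable_bind lg1 (computable_lo_computable ch1)).
  by move=> z; rewrite !piE.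
by apply: lo_computable_ext (lo_computable_bind lf lgh) => x; rewrite !piE.
Qed.

(* The continuation [kont j] expects a partial sum u, adds [f <|x, i|>] to it
   for i = j - 1, ..., 0, and passes the result to s. *)
Lemma lo_computable_sum f : lo_computable theta f ->
  lo_computable theta (fun x => \sum_(i < pi2 x) f <|pi1 x, val i|>).
Proof.
move=> lf.
have [c cadd] : lo_computable theta (fun z => pi2 z + f (pi1 z)).
  have lf1 : lo_computable theta (fun z => f (pi1 z)).
    by apply: lo_computable_precomp lf _; computability.
  have l2 : lo_computable theta pi2.
    by apply: computable_lo_computable; exact: computable_pi2 computable_id.
  have ch : computable (fun w => pi1 w + pi2 w).
    by apply: computable_add; computability.
  by apply: lo_computable_ext (lo_computable_op l2 lf1 ch) => z; rewrite !piE.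
have [|S cS SE] := abstraction c
  (g := fun z => <| <|pi1 (pi1 z), pi2 z|>, pi2 (pi1 z)|>); first by computability.
pose kont := fix kont (a j : nat) := if j is i.+1
  then S <| <|pi1 (pi1 a), i|>, <|pi1 (pi2 a), kont a i|>|> else pi2 (pi2 a).
have ckont : computable (fun z => kont z (pi2 (pi1 z))).
  apply: (computable_rec (f := fun a => pi2 (pi2 a))
    (g := fun z => S <| <|pi1 (pi1 (pi1 z)), pi1 (pi2 z)|>,
                        <|pi1 (pi2 (pi1 z)), pi2 (pi2 z)|>|>)
    _ _ _ _ computable_id _) => // [||a n|]; try by computability.
  by rewrite !piE.
have [|d dE] := app_precomp (g := fun z => <|kont z (pi2 (pi1 z)), 0|>).
  by computability; exact: ckont.
exists d => x q r s hr hs; set a := <|x, <|r, s|>|>.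
suff kontP j u : ([set u + \sum_(i < j) f <|pi1 x, val i|>] ~~> q) s ->
    exists2 y, app (kont a j) u y & q y.
  have [|y ky qy] := kontP (pi2 x) 0; first by rewrite add0n.
  by exists y => //; apply: dE; rewrite !piE.
elim: j u => [|j IHj] u hsu /=.
  by rewrite /a !piE; apply: hsu; rewrite /= big_ord0 addn0.
have [|y cy qy] := cadd <| <|pi1 x, j|>, u|> q r (kont a j) hr.
  move=> v ->; apply: IHj; rewrite !piE.
  by move: hsu; rewrite big_ord_recr /= addnAC addnA.
by exists y => //; apply: SE; rewrite /a !piE.
Qed.

End LoComputable.

(** * Arithmetical truth in the cofinite topology *)

Definition cofinite : nat -> set (set nat) := fun=> cofinite_sets.

Lemma lo_computable_lim f g : lo_computable cofinite g ->
    (forall x, exists N, forall m, N <= m -> g <|x, m|> = f x) ->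
  lo_computable cofinite f.
Proof.
move=> [c cg] lim.
have [|S cS SE] := abstraction c
  (g := fun z => <| <|pi1 (pi1 z), pi2 z|>, pi2 (pi1 z)|>); first by computability.
have [|d dE] := app_precomp (g := fun z => <|pi1 (pi2 z), <|0, S z|>|>).
  by computability.
exists d => x q r s hr hs.
have [|y ry qy] := hr <|0, S <|x, <|r, s|>|>|>.
  exists 0, (S <|x, <|r, s|>|>); split=> //.
  have [N Ng] := lim x; exists [set m | N <= m].
    apply: sub_finite_set (finite_II N) => m /= /negP.
    by rewrite -ltnNge.
  move=> m /= /Ng gm; have [|y cy qy] := cg <|x, m|> q r s hr.
    by rewrite gm.
  by exists y => //; apply: SE; rewrite !piE.
by exists y => //; apply: dE; rewrite !piE.
Qed.

Definition chi (P : Prop) : nat := if `[< P >] then 0 else 1.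

Lemma chi_eq0 P : (chi P == 0) = `[< P >].
Proof. by rewrite /chi; case: `[< P >]. Qed.

Lemma lo_computable_chi f (P : nat -> Prop) :
    (forall x, f x = 0 <-> P x) -> lo_computable cofinite f ->
  lo_computable cofinite (fun x => chi (P x)).
Proof.
move=> fP lf.
have ch : computable (fun z => if pi1 z == 0 then 0 else 1) by computability.
apply: lo_computable_ext (lo_computable_op lf lf ch) => x.
rewrite piE /chi; case: asboolP => [/fP->//|nPx].
by case: eqP => // /fP.
Qed.

Lemma lo_computable_forall (P : nat -> nat -> Prop) :
    lo_computable cofinite (fun z => chi (P (pi1 z) (pi2 z))) ->
  lo_computable cofinite (fun x => chi (forall y, P x y)).
Proof.
move=> /lo_computable_sum; set sum := (fun z => \sum_(i < _) _) => lsum.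
have sumP z : sum z = 0 <-> forall i, i < pi2 z -> P (pi1 z) i.
  split=> [/eqP|allP].
    rewrite sum_nat_eq0 => /forallP sum0 i lti.
    by have := sum0 (Ordinal lti); rewrite !piE chi_eq0 => /asboolP.
  apply/eqP; rewrite sum_nat_eq0; apply/forallP => i.
  by rewrite /= !piE chi_eq0; apply/asboolP; exact: allP.
apply: lo_computable_lim (lo_computable_chi sumP lsum) _ => x.
have [allP|] := pselect (forall y, P x y).
  exists 0 => m _; congr chi; apply/propext; split=> // _ i _.
  by rewrite piE.
move=> /existsNP [y nPy]; exists y.+1 => m lt_ym.
congr chi; apply/propext; split=> [|allP i _]; last by rewrite piE.
by rewrite !piE => /(_ y lt_ym).
Qed.

Lemma lo_computable_not (P : nat -> Prop) :
    lo_computable cofinite (fun x => chi (P x)) ->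
  lo_computable cofinite (fun x => chi (~ P x)).
Proof.
move=> lP.
have ch : computable (fun z => 1 - pi1 z) by apply: computable_sub; computability.
apply: lo_computable_ext (lo_computable_op lP lP ch) => x.
by rewrite piE /chi asbool_neg; case: `[< P x >].
Qed.

Lemma lo_computable_and (P Q : nat -> Prop) :
    lo_computable cofinite (fun x => chi (P x)) ->
    lo_computable cofinite (fun x => chi (Q x)) ->
  lo_computable cofinite (fun x => chi (P x /\ Q x)).
Proof.
move=> lP lQ.
have ch : computable (fun z => pi1 z + pi2 z) by apply: computable_add; computability.
apply: lo_computable_chi (lo_computable_op lP lQ ch) => x.
rewrite !piE -eq_opE addn_eq0 !chi_eq0.
by rewrite -asbool_and; split=> /asboolP.
Qed.

(* Every number codes a valuation, almost everywhere zero. *)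
Fixpoint env (x i : nat) : nat := if i is j.+1 then env (pi2 x) j else pi1 x.

Fixpoint env_update (i x a : nat) : nat :=
  if i is j.+1 then <|pi1 x, env_update j (pi2 x) a|> else <|a, pi2 x|>.

Lemma env_updateE i x a : env (env_update i x a) = update (env x) i a.
Proof.
apply/funext => j; rewrite /update.
elim: i x j => [|i IHi] x [|j] //=; rewrite piE //.
Qed.

Lemma env_singleton n : env <|n, 0|> = update (fun=> 0) 0 n.
Proof.
have env0 j : env 0 j = 0 by elim: j => //= j; rewrite pi2_0.
by apply/funext => -[|j] /=; rewrite piE.
Qed.

Lemma computable_env i f : computable f -> computable (fun x => env (f x) i).
Proof.
by elim: i f => [|i IHi] f cf /=; [|apply: IHi]; computability.
Qed.

Lemma computable_env_update i f g : computable f -> computable g ->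
  computable (fun x => env_update i (f x) (g x)).
Proof.
by elim: i f => [|i IHi] f cf cg /=; computability; apply: IHi; computability.
Qed.

Lemma computable_term_val t : computable (fun x => term_val (env x) t).
Proof.
elim: t => [i|||s IHs t IHt|s IHs t IHt] /=.
- exact: computable_env computable_id.
- exact: computable_const.
- exact: computable_const.
- exact: computable_add.
- exact: computable_mul.
Qed.

Lemma lo_computable_sat f : lo_computable cofinite (fun x => chi (sat (env x) f)).
Proof.
have updP i g : lo_computable cofinite (fun x => chi (sat (env x) g)) ->
    lo_computable cofinite
      (fun z => chi (sat (update (env (pi1 z)) i (pi2 z)) g)).
  have cupd : computable (fun z => env_update i (pi1 z) (pi2 z)).
    by apply: computable_env_update; computability.
  move=> lg; apply: lo_computable_ext (lo_computable_precomp lg cupd) => z.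
  by rewrite env_updateE.
have ct := computable_term_val.
elim: f => [s t|s t|f IHf|f IHf g IHg|f IHf g IHg|f IHf g IHg|i f IHf|i f IHf] /=.
- apply: (lo_computable_chi (f := fun x =>
    (term_val (env x) s - term_val (env x) t) +
    (term_val (env x) t - term_val (env x) s)) _ _) => [x|].
    split=> [/eqP|->]; last by rewrite subnn.
    by rewrite addn_eq0 !subn_eq0 -eqn_leq => /eqP.
  apply: computable_lo_computable; apply: computable_add;
    by apply: computable_sub.
- apply: (lo_computable_chi (f := fun x =>
    (term_val (env x) s).+1 - term_val (env x) t) _ _) => [x|].
    by rewrite -eq_opE subn_eq0.
  apply: computable_lo_computable; apply: computable_sub => //.
  exact: computable_succ.
- exact: lo_computable_not.
- exact: lo_computable_and.
- apply: lo_computable_ext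
    (lo_computable_not (lo_computable_and (lo_computable_not IHf)
                                          (lo_computable_not IHg))) => x.
  by congr chi; apply/propext; rewrite -not_orE notK.
- apply: lo_computable_ext
    (lo_computable_not (lo_computable_and IHf (lo_computable_not IHg))) => x.
  by congr chi; apply/propext; rewrite -not_implyE notK.
- exact/lo_computable_forall/updP.
- apply: lo_computable_ext (lo_computable_not (lo_computable_forall
    (P := fun x a => ~ sat (update (env x) i a) f)
    (lo_computable_not (updP i _ IHf)))) => x.
  by congr chi; apply/propext; rewrite forallNE notK.
Qed.

Lemma rhoE D n : rho D n = [set [set chi (D n)]].
Proof. by rewrite /rho /chi /in_mem /= /in_set; case: asboolP. Qed.

Lemma lo_computable_effective D theta :
  lo_computable theta (fun n => chi (D n)) -> effective_in D theta.
Proof.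
move=> [c cD].
have [|S cS SE] := abstraction c
  (g := fun z => <|pi1 (pi2 z), <|pi1 z, pi2 (pi2 z)|>|>); first by computability.
have [|d dE] := app_precomp
  (g := fun z => <|pi1 z, <|S (pi1 (pi2 z)), pi2 (pi2 z)|>|>); first by computability.
have [L [l lL] LE] := smn d.
exists (encode l) => p _ z lo_z; exists (L z); first by exists l.
move=> q _ _ [r [s [hr hs ->]]].
have [|y zy qy] := lo_z q I <|S r, s|>.
  exists (S r), s; split=> // _ [n [e [-> [A]]]]; rewrite rhoE => -> he.
  have [y cy qy] := cD n q r e hr he.
  by exists y => //; apply: SE; rewrite !piE.
by exists y => //; apply/LE/dE; rewrite !piE.
Qed.

Theorem theorem3p6p23 (D : set nat) (k : nat) (k_ge2 : 2 <= k)
    (k_even : ~~ odd k) (phi : formula) (phi_Delta0 : Delta0 phi)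
    (phi_free : forall i, i \in free_vars phi -> i <= k)
    (phi_defines_D :
       forall n, D n <-> holds_at (alternating true 1 k phi) n) :
  effective_in D (fun=> cofinite_sets).
Proof.
apply: lo_computable_effective.
have cpair : computable (fun n => <|n, 0|>) by computability.
apply: lo_computable_ext
  (lo_computable_precomp (lo_computable_sat (alternating true 1 k phi)) cpair) => n.
by rewrite env_singleton; congr chi; apply/propext; split=> /phi_defines_D.
Qed.
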